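(* Let $e_1,\dots,e_n:\Omega\to\mathbb{C}$ be linearly independent functions, let $T_1,\dots,T_n\in\Omega$ be the nodes selected by the Empirical Interpolation Method (EIM) with input $\{e_i\}_{i=1}^n$, and let $r_2,\dots,r_n$ be the residuals it computes, i.e. $r_j(t)=e_j(t)-\mathcal{I}_{j-1}[e_j](t)$. For $1\le j\le n$ and points $s_1,\dots,s_j\in\Omega$ let $V_j(s_1,\dots,s_j):=\det\big(e_k(s_i)\big)_{i,k=1}^{j}$, so that $\det(\mathbf{V}_j)=V_j(T_1,\dots,T_j)$. Then, for every $j=2,3,\dots,n$ and every $t\in\Omega$, $$ r_j(t)=\frac{V_j(T_1,\ldots,T_{j-1},t)}{V_{j-1}(T_1,\ldots,T_{j-1})}. $$ In consequence, for the node $T_j$ chosen at this iteration, $$ r_j(T_j)=\frac{V_j(T_1,\ldots,T_{j-1},T_j)}{V_{j-1}(T_1,\ldots,T_{j-1})}=\frac{\det(\mathbf{V}_j)}{\det(\mathbf{V}_{j-1})}. $$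
   Context: Let $\Omega$ be the domain of the time variable $t$ (a time interval or a finite grid of sampled times), and let $\{e_i\}_{i=1}^n$ be a basis (linearly independent set) of complex-valued functions on $\Omega$. All maxima over $t\in\Omega$ appearing below are assumed to be attained; $\mathrm{argmax}_t$ denotes any point at which the maximum is attained. Vandermonde-like matrix (V-matrix). Given nodes $T_1,\dots,T_j\in\Omega$, $\mathbf{V}_j$ is the $j\times j$ matrix with entries $(\mathbf{V}_j)_{ik}:=e_k(T_i)$, $1\le i,k\le j$. Interpolant. When $\mathbf{V}_j$ is invertible, the interpolant of a function $f:\Omega\to\mathbb{C}$ at the nodes $T_1,\dots,T_j$ is the unique function $\mathcal{I}_j[f]=\sum_{i=1}^j C_i e_i$ with $C_i\in\mathbb{C}$ such that $\mathcal{I}_j[f](T_k)=f(T_k)$ for $k=1,\dots,j$. Equivalently, $\mathcal{I}_j[f](t)=\sum_{i=1}^j B_i(t)f(T_i)$ with $B_i(t)=\sum_{k=1}^j(\mathbf{V}_j^{-1})_{ki}e_k(t)$. Empirical Interpolation Method (EIM). Input: $\{e_i\}_{i=1}^n$. Set $T_1=\mathrm{argmax}_t|e_1(t)|$. For $j=2,\dots,n$: build $\mathcal{I}_{j-1}[e_j]$, the interpolant of $e_j$ in the span of $e_1,\dots,e_{j-1}$ at the nodes $T_1,\dots,T_{j-1}$; set the residual $r_j(t)=e_j(t)-\mathcal{I}_{j-1}[e_j](t)$; set $T_j=\mathrm{argmax}_t|r_j(t)|$. Output: nodes $T_1,\dots,T_n$ and interpolant $\mathcal{I}_n$. By the linear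 independence of the $e_i$ and the choice of the nodes, $\det(\mathbf{V}_j)\neq0$ for all $j$, so each interpolant in the loop is well defined. *)

(* Defs.v *)
From mathcomp Require Import all_boot all_order all_algebra.
From mathcomp Require Import boolp classical_sets reals complex.

Set Implicit Arguments.
Unset Strict Implicit.
Unset Printing Implicit Defensive.

Import Order.TTheory GRing.Theory Num.Theory.
Local Open Scope ring_scope.

(* Indices start at 0: [e k] and [T k] with [k : 'I_n] are the (k+1)-st basis
   function and the (k+1)-st node.  A proof [hj : j <= n] serves to view the
   indices in ['I_j] as the first [j] indices in ['I_n]. *)

Section EIM.
Variables (R : realType) (Omega : Type) (n : nat).
Implicit Types (e : 'I_n -> Omega -> R[i]) (T : 'I_n -> Omega).
Implicit Types (f g : Omega -> R[i]) (j : nat).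

Definition lin_indep e : Prop :=
  forall c : 'I_n -> R[i],
    (forall t : Omega, \sum_(i < n) c i * e i t = 0) -> forall i, c i = 0.

(* The norm of [R[i]] takes values in [R[i]]; these are real, hence comparable
   for the partial order of [R[i]]. *)
Definition is_argmax_norm f (t : Omega) : Prop :=
  forall s : Omega, `|f s| <= `|f t|.

Definition Vmx e j (hj : (j <= n)%N) (s : j.-tuple Omega) : 'M[R[i]]_j :=
  \matrix_(i < j, k < j) e (widen_ord hj k) (tnth s i).

Definition Vdet e j (hj : (j <= n)%N) (s : j.-tuple Omega) : R[i] :=
  \det (Vmx e hj s).

Definition first_nodes T j (hj : (j <= n)%N) : j.-tuple Omega :=
  [tuple T (widen_ord hj i) | i < j].

Definition interpolates e j (hj : (j <= n)%N) (s : j.-tuple Omega) f g : Prop :=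
  (exists c : 'I_j -> R[i],
     forall t : Omega, g t = \sum_(i < j) c i * e (widen_ord hj i) t)
  /\ (forall k : 'I_j, g (tnth s k) = f (tnth s k)).

(* The function [g] with [interpolates e hj s f g]: it exists and is unique when
   [Vmx e hj s] is invertible.  The zero function is the default value when
   no such [g] exists. *)
Definition interpolant e j (hj : (j <= n)%N) (s : j.-tuple Omega) f :
    Omega -> R[i] :=
  xget (fun=> 0) [set g | interpolates e hj s f g]%classic.

(* [e j] minus its interpolant by the [j] functions of smaller index at the
   [j] nodes of smaller index. *)
Definition residual e T (j : 'I_n) : Omega -> R[i] :=
  let hj : (j <= n)%N := ltnW (ltn_ord j) in
  fun t => e j t - interpolant e hj (first_nodes T hj) (e j) t.

(* [T] is a possible output of the algorithm: maximum points need not be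
   unique, and any of them may be chosen at each step. *)
Definition EIM_nodes e T : Prop :=
  (forall j : 'I_n, nat_of_ord j = 0%N -> is_argmax_norm (e j) (T j))
  /\ (forall j : 'I_n, (0 < j)%N -> is_argmax_norm (residual e T j) (T j)).

End EIM.

(* Main.v *)
(** Expanding V_(j+1)(T_1, ..., T_j, t) along its last row exhibits it as a
    combination of e_1(t), ..., e_(j+1)(t) in which e_(j+1) has coefficient
    V_j(T_1, ..., T_j); it vanishes at t = T_1, ..., T_j because two rows then
    coincide.  Hence e_(j+1) - V_(j+1)(T_1, ..., T_j, t) / V_j(T_1, ..., T_j)
    satisfies the two conditions that characterise the interpolant of e_(j+1).
    The same expansion gives V_j <> 0 by induction: if the residual vanished at
    its maximum point T_(j+1), it would be zero everywhere, and the expansion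
    would be a nontrivial linear relation. *)

Require Import Defs.
From mathcomp Require Import all_boot all_order all_algebra.
From mathcomp Require Import boolp classical_sets reals complex.

Set Implicit Arguments.
Unset Strict Implicit.
Unset Printing Implicit Defensive.

Import Order.TTheory GRing.Theory Num.Theory.
Local Open Scope ring_scope.

Section RconsTuple.
Variables (A : Type) (j : nat) (s : j.-tuple A) (t : A).

Lemma tnth_rcons_ord_max : tnth [tuple of rcons s t] ord_max = t.
Proof. by rewrite (tnth_nth t) nth_rcons size_tuple ltnn eqxx. Qed.

Lemma tnth_rcons_lift (k : 'I_j) :
  tnth [tuple of rcons s t] (lift ord_max k) = tnth s k.
Proof.
by rewrite !(tnth_nth t) lift_max /= nth_rcons size_tuple ltn_ord.
Qed.

End RconsTuple.

Section Determinants.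
Variables (R : realType) (Omega : Type) (n : nat).
Implicit Types (e : 'I_n -> Omega -> R[i]) (T : 'I_n -> Omega).

Lemma lin_indep_widen e m (hm : (m <= n)%N) (c : 'I_m -> R[i]) :
  lin_indep e ->
  (forall t, \sum_(k < m) c k * e (widen_ord hm k) t = 0) ->
  forall k, c k = 0.
Proof.
move=> e_indep c0 k.
(* [d] extends [c] by zero to all of ['I_n]. *)
pose d (i : 'I_n) : R[i] := oapp c 0 (insub (i : nat)).
have dE l : d (widen_ord hm l) = c l by rewrite /d /= valK.
rewrite -dE; apply: e_indep => t.
rewrite (bigID (fun i : 'I_n => (i < m)%N)) /= [X in _ + X]big1 ?addr0.
  rewrite big_ord_narrow -[RHS](c0 t).
  by apply: eq_bigr => l _; rewrite dE.
by move=> i /negbTE im; rewrite /d insubF //= mul0r.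
Qed.

(** The difference of the two coefficient vectors lies in the kernel of the invertible V-matrix. *)
Lemma interpolates_uniq e j (hj : (j <= n)%N) (s : j.-tuple Omega) f g h :
  Vdet e hj s != 0 -> interpolates e hj s f g -> interpolates e hj s f h ->
  g =1 h.
Proof.
move=> V0 [[c gE] gf] [[d hE] hf].
pose u : 'cV[R[i]]_j := \col_k (c k - d k).
have Vu : Vmx e hj s *m u = 0.
  apply/colP => i; rewrite !mxE -[RHS](subrr (f (tnth s i))) -{1}gf -hf gE hE.
  rewrite -sumrB; apply: eq_bigr => k _; rewrite !mxE.
  by rewrite mulrC mulrBl.
have u0 : u = 0.
  have Vunit : Vmx e hj s \in unitmx by rewrite unitmxE unitfE.
  by rewrite -[u](mulKmx Vunit) Vu mulmx0.
move=> t; rewrite gE hE; apply: eq_bigr => k _; congr (_ * _).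
by apply/eqP; rewrite -subr_eq0; have /colP/(_ k) := u0; rewrite !mxE => ->.
Qed.

(** Since [g] is a witness, [xget] returns a genuine interpolant rather than its default; uniqueness
    identifies it with [g]. *)
Lemma interpolantE e j (hj : (j <= n)%N) (s : j.-tuple Omega) f g :
  Vdet e hj s != 0 -> interpolates e hj s f g -> interpolant e hj s f =1 g.
Proof.
move=> V0 fg; apply: (interpolates_uniq V0 _ fg).
exact: (@xgetPex _ (fun=> 0) [set g | interpolates e hj s f g]%classic
          (ex_intro _ g fg)).
Qed.

(* The cofactors of the last row of the matrix of V_(j+1)(s_1, ..., s_j, t),
   written without t, on which they do not depend. *)
Definition Vcofactor e j (hj1 : (j.+1 <= n)%N) (s : j.-tuple Omega)
    (k : 'I_j.+1) : R[i] :=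
  (-1) ^+ (j + k) *
  \det (\matrix_(i < j, l < j) e (widen_ord hj1 (lift k l)) (tnth s i)).

Lemma Vdet_rcons e j (hj1 : (j.+1 <= n)%N) (s : j.-tuple Omega) t :
  Vdet e hj1 [tuple of rcons s t] =
  \sum_(k < j.+1) Vcofactor e hj1 s k * e (widen_ord hj1 k) t.
Proof.
rewrite /Vdet (expand_det_row _ ord_max); apply: eq_bigr => k _.
rewrite mxE tnth_rcons_ord_max mulrC /cofactor /Vcofactor /=.
congr (_ * \det _ * _).
by apply/matrixP => i l; rewrite !mxE tnth_rcons_lift.
Qed.

Lemma Vcofactor_ord_max e j (hj : (j <= n)%N) (hj1 : (j.+1 <= n)%N)
    (s : j.-tuple Omega) :
  Vcofactor e hj1 s ord_max = Vdet e hj s.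
Proof.
rewrite /Vcofactor /= addnn -signr_odd odd_double expr0 mul1r; congr (\det _).
apply/matrixP => i l; rewrite !mxE; congr (e _ _).
by apply: val_inj; exact: lift_max.
Qed.

Lemma Vdet_rcons_node e j (hj1 : (j.+1 <= n)%N) (s : j.-tuple Omega) k :
  Vdet e hj1 [tuple of rcons s (tnth s k)] = 0.
Proof.
apply: (determinant_alternate (neq_lift ord_max k)) => l.
by rewrite !mxE tnth_rcons_ord_max tnth_rcons_lift.
Qed.

Lemma interpolates_Vdet e (j : 'I_n) (hj : (j <= n)%N) (s : j.-tuple Omega) :
  Vdet e hj s != 0 ->
  interpolates e hj s (e j)
    (fun t => e j t - Vdet e (ltn_ord j) [tuple of rcons s t] / Vdet e hj s).
Proof.
move=> V0; split; last by move=> k; rewrite Vdet_rcons_node mul0r subr0.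
(* The [ord_max] term of the expansion, divided by [Vdet e hj s], is exactly [e j t] and cancels;
   these are the coefficients that remain. *)
exists (fun k => - (Vcofactor e (ltn_ord j) s (widen_ord (leqnSn j) k)
                    / Vdet e hj s)) => t.
rewrite Vdet_rcons big_ord_recr /= (Vcofactor_ord_max _ hj).
have -> : widen_ord (ltn_ord j) ord_max = j by exact: val_inj.
rewrite mulrDl mulrAC mulfV // mul1r opprD addrCA subrr addr0.
rewrite mulr_suml -sumrN; apply: eq_bigr => k _.
rewrite mulNr mulrAC; congr (- (_ * e _ _)); exact: val_inj.
Qed.

Lemma residual_Vdet e T (j : 'I_n) (hj := ltnW (ltn_ord j)) :
  Vdet e hj (first_nodes T hj) != 0 ->
  forall t, residual e T j t =
    Vdet e (ltn_ord j) [tuple of rcons (first_nodes T hj) t]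
    / Vdet e hj (first_nodes T hj).
Proof.
move=> V0 t; rewrite /residual (interpolantE V0 (interpolates_Vdet V0)).
by rewrite subKr.
Qed.

Lemma first_nodesS T (j : 'I_n) (hj : (j <= n)%N) :
  first_nodes T (ltn_ord j) = [tuple of rcons (first_nodes T hj) (T j)].
Proof.
apply: eq_from_tnth => i; rewrite tnth_mktuple.
case: (unliftP ord_max i) => [k|] ->.
  rewrite tnth_rcons_lift tnth_mktuple; congr (T _).
  by apply: val_inj; exact: lift_max.
by rewrite tnth_rcons_ord_max; congr (T _); apply: val_inj.
Qed.

(** Merges the two clauses of [EIM_nodes]: at index 0 the interpolant is an empty sum, so the
    residual is [e j] itself. *)
Lemma is_argmax_residual e T (j : 'I_n) :
  EIM_nodes e T ->
  Vdet e (ltnW (ltn_ord j)) (first_nodes T (ltnW (ltn_ord j))) != 0 ->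
  is_argmax_norm (residual e T j) (T j).
Proof.
move=> [T0 Tj] V0; have [j_gt0|j_le0] := ltnP 0 j; first exact: Tj.
have j0 : nat_of_ord j = 0%N by apply/eqP; rewrite -leqn0.
have rE t : residual e T j t = e j t.
  have [[c gE] _] := interpolates_Vdet V0.
  rewrite /residual (interpolantE V0 (interpolates_Vdet V0)) gE big1 ?subr0//.
  (* The first occurrence of [j] is hidden in the coercion of [k]; only the bound is rewritten,
     giving the absurd [k < 0]. *)
  by move=> k; have := ltn_ord k; rewrite {2}j0.
by move=> s; rewrite !rE; apply: T0.
Qed.

Lemma Vdet_first_nodes_neq0 e T m (hm : (m <= n)%N) :
  lin_indep e -> EIM_nodes e T -> Vdet e hm (first_nodes T hm) != 0.
Proof.
move=> e_indep T_EIM; elim: m hm => [|m IHm] hm.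
  (* The induction starts at the empty determinant, which is 1. *)
  by rewrite /Vdet det_mx00 oner_neq0.
pose j := Ordinal hm; have V0 := IHm (ltnW (ltn_ord j)).
rewrite (bool_irrelevance hm (ltn_ord j)).
rewrite (first_nodesS _ (ltnW (ltn_ord j))).
apply/eqP => VT0.
have r0 t : residual e T j t = 0.
  have := @is_argmax_residual e T j T_EIM V0 t.
  rewrite [residual e T j (T j)]residual_Vdet // VT0 mul0r normr0.
  by rewrite normr_le0 => /eqP.
have cofactor0 t : \sum_(k < j.+1) Vcofactor e (ltn_ord j)
    (first_nodes T (ltnW (ltn_ord j))) k * e (widen_ord (ltn_ord j) k) t = 0.
  rewrite -Vdet_rcons; apply/eqP; have /eqP := r0 t.
  by rewrite residual_Vdet // mulf_eq0 invr_eq0 (negbTE V0) orbF.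
(* The last coefficient of this relation is the previous determinant, nonzero by [V0]. *)
have := lin_indep_widen e_indep cofactor0 ord_max.
by rewrite (Vcofactor_ord_max _ (ltnW (ltn_ord j))) => /eqP; apply/negP.
Qed.

End Determinants.

Theorem mainTheorem1 (R : realType) (Omega : Type) (n : nat)
    (e : 'I_n -> Omega -> R[i]) (T : 'I_n -> Omega)
    (e_indep : lin_indep e) (T_EIM : EIM_nodes e T)
    (j : 'I_n) (j_gt0 : (0 < j)%N) :
  let hj : (j <= n)%N := ltnW (ltn_ord j) in
  let hj1 : (j.+1 <= n)%N := ltn_ord j in
  let prev : j.-tuple Omega := first_nodes T hj in
  [/\ Vdet e hj prev != 0,
      forall t : Omega,
        residual e T j t = Vdet e hj1 [tuple of rcons prev t] / Vdet e hj prev,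
      residual e T j (T j)
        = Vdet e hj1 [tuple of rcons prev (T j)] / Vdet e hj prev
    & Vdet e hj1 [tuple of rcons prev (T j)] / Vdet e hj prev
        = \det (Vmx e hj1 (first_nodes T hj1)) / \det (Vmx e hj prev)].
Proof.
move=> hj hj1 prev.
have V0 : Vdet e hj prev != 0 by exact: Vdet_first_nodes_neq0.
split=> //; [exact: residual_Vdet | exact: residual_Vdet |].
by rewrite /hj1 (first_nodesS _ hj).
Qed.
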